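(* Let $\{X_n\}_{n=1}^{\infty}$ be a sequence of pairwise independent identically distributed real-valued random variables on a probability space, and let $S_n=\sum_{k=1}^{n}X_k$ for $n\geqslant 1$. Let $0<p<2$. Then $E|X_1|^p<\infty$ if and only if $$\frac{S_n-nb}{n^{1/p}}\to 0 \quad\text{almost surely as } n\to\infty,$$ where $b=0$ if $0<p<1$, and $b=EX_1$ if $1\leqslant p<2$.
   Context: Pairwise independent means that $X_i$ and $X_j$ are independent for all $i\neq j$ (joint independence of the whole sequence is not assumed). $E$ denotes expectation. When $1\leqslant p<2$, the convergence relation with $b=EX_1$ is understood to include that $EX_1$ exists and is finite. *)

(* Defs.v *)
From HB Require Import structures.
From mathcomp Require Import all_boot all_order all_algebra.
From mathcomp Require Import all_classical all_reals all_analysis.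

Set Implicit Arguments.
Unset Strict Implicit.
Unset Printing Implicit Defensive.

Import Order.TTheory GRing.Theory Num.Theory.
Import numFieldNormedType.Exports.

Local Open Scope classical_set_scope.
Local Open Scope ring_scope.

Section pairwise_iid.
Context d (T : measurableType d) d' (T' : measurableType d') (R : realType).
Variable P : probability T R.

Definition independent_RV (X Y : {RV P >-> T'}) : Prop :=
  forall A B : set T', measurable A -> measurable B ->
    P ((X @^-1` A) `&` (Y @^-1` B)) = (P (X @^-1` A) * P (Y @^-1` B))%E.

Definition pairwise_independent (X : nat -> {RV P >-> T'}) : Prop :=
  forall i j : nat, i != j -> independent_RV (X i) (X j).

(* The two laws are compared on measurable sets only: [distribution P _] also
   has (irrelevant) values on non-measurable sets, so Leibniz equality of the
   set functions would be too strong. *)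
Definition identically_distributed (X : nat -> {RV P >-> T'}) : Prop :=
  forall (i j : nat) (A : set T'), measurable A ->
    distribution P (X i) A = distribution P (X j) A.

End pairwise_iid.

Section partial_sums.
Context d (T : measurableType d) (R : realType) (P : probability T R).

(* Sequences are indexed from 0: [X k] stands for X_(k+1), so that
   [partial_sum X n] is X_1 + ... + X_n. *)
Definition partial_sum (X : nat -> {RV P >-> R}) (n : nat) (w : T) : R :=
  \sum_(k < n) X k w.

(* For 1 <= p this is the mean of X_1 only when X_1 is integrable ([fine] sends
   infinite values to 0), so integrability has to be required separately. *)
Definition centering (p : R) (X1 : {RV P >-> R}) : R :=
  if p < 1 then 0 else fine ('E_P[X1])%E.

End partial_sums.

(* Main.v *)
Require Import Defs.
From HB Require Import structures.
From mathcomp Require Import all_boot all_order all_algebra.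
From mathcomp Require Import all_classical all_reals all_analysis.
From mathcomp Require Import measurable_realfun lra ring zify.

(** Splitting [X] into positive and negative parts, assume [X >= 0]. Put
    [r = 2^(1/p)], truncate at level [r^m] on blocks of length [2^m], and let [b],
    [b_m] be the full and truncated means.

    Case [1 <= p < 2]. The interval [[0, j)], [j <= 2^n], is a disjoint union of at
    most one dyadic block per scale [m < n] (or one block of length [2^n]).
    Truncating only decreases a nonnegative sum, so [S_j - j b] is at least minus
    the sum over [m] of the largest centred truncated block sum at scale [m], minus
    the sum of [2^m (b - b_m)]. The same bound for [[j, 2^n)] and
    [S_j = S_(2^n) - (S_(2^n) - S_j)] give the upper bound, so no maximal inequality
    is needed. Pairwise independence is used only for the variances of the block
    sums; weighted by [(r^n t^(n-m))^(-2)] with [t < 1], their sum over blocks,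
    scales and [n] is at most a multiple of [E X^p]. Moreover
    [2^m (b - b_m) = o(r^m)] by dominated convergence. For [p < 1] the expectation
    of the truncated sum is already summable after division by [r^n].

    Conversely, convergence forces [|X_n|^p <= n] eventually almost surely, and a
    Borel-Cantelli lemma for pairwise independent events gives [E |X|^p < oo]. *)

Import Order.TTheory GRing.Theory Num.Theory.
Import numFieldNormedType.Exports.

Local Open Scope classical_set_scope.
Local Open Scope ring_scope.

(** * Dyadic and geometric sums *)

(** Each [a m] enters the double sum with weights 1, t, t^2, ..., of total at most 1 / (1 - t) when
    t < 1. Instead of exchanging sums, the induction carries an exact identity whose remainder is t
    times the last inner sum. *)
Lemma sum_conv_geometric_le (R : realFieldType) (t : R) (a : nat -> R) (N : nat) :
  0 <= t -> (forall m, 0 <= a m) ->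
  (1 - t) * (\sum_(n < N) \sum_(m < n.+1) a m * t ^+ (n - m))
    <= \sum_(m < N) a m.
Proof.
move=> t0 a0.
suff -> : \sum_(m < N) a m =
    (1 - t) * (\sum_(n < N) \sum_(m < n.+1) a m * t ^+ (n - m)) +
    t * (if N is M.+1 then \sum_(m < M.+1) a m * t ^+ (M - m) else 0).
  rewrite lerDl mulr_ge0//; case: N => // N.
  by apply: sumr_ge0 => i _; rewrite mulr_ge0// exprn_ge0.
elim: N => [|N IH]; first by rewrite !big_ord0 !mulr0 addr0.
set B := (if N is _.+1 then _ else _) in IH.
rewrite big_ord_recr IH /= [in RHS]big_ord_recr /=.
have -> : \sum_(m < N.+1) a m * t ^+ (N - m) = a N + t * B.
  rewrite big_ord_recr /= subnn expr0 mulr1 addrC; congr (_ + _).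
  rewrite /B; case: (N) => [|M]; first by rewrite big_ord0 mulr0.
  rewrite mulr_sumr; apply: eq_bigr => i _.
  by rewrite subSn -1?ltnS// exprS mulrCA.
by ring.
Qed.

Lemma sum_geometric_rev_le (R : realFieldType) (t : R) (n : nat) : 0 <= t ->
  (1 - t) * (\sum_(m < n.+1) t ^+ (n - m)) <= 1.
Proof.
move=> t0; elim: n => [|n IH]; first by rewrite big_ord1 expr0; lra.
rewrite big_ord_recr/= subnn expr0.
rewrite (eq_bigr (fun m : 'I_n.+1 => t * t ^+ (n - m))); last first.
  by move=> i _; rewrite subSn -1?ltnS// exprS.
by rewrite -mulr_sumr; nra.
Qed.

(** The convolution obeys u_(n+1) = t u_n + a_(n+1), a contraction driven by a null sequence. *)
Lemma conv_geometric_cvg0 (R : realType) (t : R) (a : nat -> R) :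
  0 <= t < 1 -> a @ \oo --> (0 : R) ->
  (\sum_(m < n.+1) a m * t ^+ (n - m)) @[n --> \oo] --> (0 : R).
Proof.
move=> /andP[t0 t1] a0.
pose u n := \sum_(m < n.+1) a m * t ^+ (n - m).
have uS n : u n.+1 = t * u n + a n.+1.
  rewrite /u big_ord_recr /= subnn expr0 mulr1; congr (_ + _).
  rewrite mulr_sumr; apply: eq_bigr => i _.
  by rewrite subSn -1?ltnS// exprS mulrCA.
apply/cvgr0Pnorm_le => e e0.
(* With this bound on [a], the value e / 2 is the fixed point of x -> t x + (1 - t) e / 2, so only
   t^k |u_N| has to die out. *)
have e2 : 0 < (1 - t) * (e / 2) by rewrite mulr_gt0 ?subr_gt0// divr_gt0.
move/cvgr0Pnorm_le : a0 => /(_ _ e2)[N _ aN].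
have uN k : `|u (N + k)%N| <= t ^+ k * `|u N| + e / 2.
  elim: k => [|k IH]; first by rewrite addn0 expr0 mul1r lerDl divr_ge0// ltW.
  rewrite addnS uS (le_trans (ler_normD _ _))// normrM (ger0_norm t0).
  have := aN (N + k).+1 (leqW (leq_addr _ _)) => /= ?.
  rewrite exprS -mulrA.
  have := ler_wpM2l t0 IH; nra.
have : (fun k => t ^+ k * `|u N|) @ \oo --> 0 * `|u N|.
  by apply: cvgMl; apply: cvg_expr; rewrite ger0_norm.
rewrite mul0r => /cvgr0Pnorm_le /(_ (e / 2)) [|M _ HM]; first by rewrite divr_gt0.
exists (N + M)%N => // n /= nNM.
have nN : n = (N + (n - N))%N by lia.
have MnN : (M <= n - N)%N by lia.
rewrite -/(u n) nN (le_trans (uN _))//.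
have := HM _ MnN; rewrite ger0_norm ?mulr_ge0 ?exprn_ge0// => ?.
lra.
Qed.

(** Bisection: of the two halves of a block, the one without j is a full block one scale below and
    costs one [c m]; the other is treated recursively. At scale 0 a single point remains, on one
    side or the other of j, whence the extra [c 0]. *)
Lemma dyadic_chaining (R : realDomainType) (f c : nat -> R) (N : nat) :
  (forall m, 0 <= c m) ->
  (forall m k, (k.+1 * 2 ^ m <= 2 ^ N)%N ->
    - c m <= \sum_(k * 2 ^ m <= i < k.+1 * 2 ^ m) f i) ->
  forall j, (j <= 2 ^ N)%N ->
    - (c 0%N + \sum_(m < N) c m) <= \sum_(0 <= i < j) f i /\
    - (c 0%N + \sum_(m < N) c m) <= \sum_(j <= i < 2 ^ N) f i.
Proof.
move=> c0 fc.
(* The recursion needs any aligned block containing j, and both sides of j at once. *)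
suff H n k j : (k.+1 * 2 ^ n <= 2 ^ N)%N -> (k * 2 ^ n <= j <= k.+1 * 2 ^ n)%N ->
    - (c 0%N + \sum_(m < n) c m) <= \sum_(k * 2 ^ n <= i < j) f i /\
    - (c 0%N + \sum_(m < n) c m) <= \sum_(j <= i < k.+1 * 2 ^ n) f i.
  by move=> j jN; have := H N 0%N j; rewrite mul0n mul1n; apply.
elim: n k j => [|n IH] k j kN /andP[kj jk].
  rewrite big_ord0 addr0; have := fc 0%N k kN.
  move: kj jk; rewrite expn0 !muln1 => kj jk fk.
  have [->|->] : j = k \/ j = k.+1 by lia.
    by split => //; rewrite big_geq// oppr_le0.
  by split => //; rewrite big_geq// oppr_le0.
have E1 : (k * 2 ^ n.+1 = k.*2 * 2 ^ n)%N by rewrite expnS; lia.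
have E2 : (k.+1 * 2 ^ n.+1 = k.*2.+2 * 2 ^ n)%N by rewrite expnS; lia.
have cS : 0 <= c 0%N + \sum_(m < n) c m by rewrite addr_ge0// sumr_ge0.
rewrite E1 E2 in kj jk kN *; rewrite big_ord_recr/=.
have lt1 : (k.*2.+1 * 2 ^ n <= k.*2.+2 * 2 ^ n)%N by rewrite leq_mul2r leqnSn orbT.
have lt0 : (k.*2 * 2 ^ n <= k.*2.+1 * 2 ^ n)%N by rewrite leq_mul2r leqnSn orbT.
have kN' := leq_trans lt1 kN.
have L := fc n k.*2 kN'; have Rt := fc n k.*2.+1 kN.
have cn := c0 n.
have [jm|mj] := leqP j (k.*2.+1 * 2 ^ n).
  have [|H1 H2] := IH k.*2 j kN'; first by rewrite kj jm.
  split; first lra.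
  rewrite (@big_cat_nat _ _ _ (k.*2.+1 * 2 ^ n)%N)//=; lra.
have [|H1 H2] := IH k.*2.+1 j kN; first by rewrite (ltnW mj) jk.
split; last lra.
rewrite (@big_cat_nat _ _ _ (k.*2.+1 * 2 ^ n)%N)//=; last exact: ltnW.
lra.
Qed.

(* Once [b] holds it keeps holding, so the sum is a geometric tail dominated by
   its first term. *)
Lemma geometric_tail_le (R : realFieldType) (q x B : R) (b : nat -> bool) (N : nat) :
  0 <= q <= 1 -> 0 <= x -> 0 <= B ->
  (forall m, b m -> b m.+1) -> (forall m, b m -> x * q ^+ m <= B) ->
  (1 - q) * (\sum_(m < N) q ^+ m * (if b m then x else 0)) <= B.
Proof.
move=> /andP[q0 q1] x0 B0 bS bB.
(* Either nothing has been summed yet, or the tail still to come, x q^N after multiplication by 1 -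
   q, is kept as slack below B; this makes the induction close. *)
have : (forall m, (m < N)%N -> ~~ b m) /\
      (1 - q) * (\sum_(m < N) q ^+ m * (if b m then x else 0)) = 0 \/
    (forall m, (N <= m)%N -> b m) /\
    (1 - q) * (\sum_(m < N) q ^+ m * (if b m then x else 0)) <= B - x * q ^+ N;
  last first.
  by move=> [[_ ->]//|[_ H]]; rewrite (le_trans H)// gerBl mulr_ge0// exprn_ge0.
elim: N => [|N [[bN IH]|[bN IH]]].
- by left; rewrite big_ord0 mulr0.
- rewrite big_ord_recr/= mulrDr IH add0r; case: ifPn => [bNN|nbN].
    right; split; first by elim=> // m IHm; rewrite leq_eqVlt => /predU1P[[<-]|/IHm/bS//]; exact: (bS _ bNN).
    by rewrite exprS; have := bB _ bNN; lra.
  left; rewrite !mulr0; split => // m; rewrite ltnS leq_eqVlt => /predU1P[->//|].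
  exact: bN.
- right; split; first by move=> m /ltnW/bN.
  rewrite big_ord_recr/= mulrDr (bN N)// exprS; lra.
Qed.

Lemma sum_pow2_lt_le (R : realFieldType) (y : R) (N : nat) : 0 <= y ->
  \sum_(n < N) 2 ^+ n * (2 ^+ n < y)%R%:R <= 2 * y.
Proof.
move=> y0.
have y2 : 0 <= 2 * y by lra.
pose S M := \sum_(n < M) 2 ^+ n * (2 ^+ n < y)%R%:R : R.
(* The second bound absorbs the next term: if 2^N < y, then S N + 2^N <= 2 * 2^N <= 2 y. *)
have H : S N <= 2 * y /\ S N <= 2 ^+ N; last by case: H.
rewrite /S; elim: N => [|N [IH1 IH2]].
  by rewrite big_ord0 expr0 ler01.
have p2 : (0 : R) < 2 ^+ N by rewrite exprn_gt0.
rewrite big_ord_recr/= exprS; case: ltP => [yN|yN] /=; last first.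
  by rewrite mulr0 addr0; split => //; lra.
by rewrite mulr1; split; lra.
Qed.

(** * Powers at the scales r^m, r = 2^(1/p) *)

Lemma powR2V_powR (R : realType) (p : R) (m : nat) : 0 < p ->
  ((2 `^ p^-1) ^+ m) `^ p = 2 ^+ m :> R.
Proof.
move=> p0; rewrite -powR_mulrn ?powR_ge0// -powRrM -powRrM.
by rewrite mulrCA mulVf ?gt_eqF// mulr1 powR_mulrn.
Qed.

Lemma powR_gt1 (R : realType) (a r : R) : 1 < a -> 0 < r -> 1 < a `^ r.
Proof.
move=> a1 r0; have <- : 1 `^ r = 1 :> R by rewrite powR1.
by rewrite gt0_ltr_powR// nnegrE ?ler01// (le_trans ler01 (ltW a1)).
Qed.

Lemma le_pow2_powR (R : realType) (p x : R) (m : nat) : 0 < p -> 0 <= x ->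
  (x <= (2 `^ p^-1) ^+ m) = (x `^ p <= 2 ^+ m).
Proof.
move=> p0 x0; rewrite -(@powR2V_powR _ p)//.
apply/idP/idP => [|]; last first.
  by apply: contraTT; rewrite -!ltNge; apply: gt0_ltr_powR; rewrite ?nnegrE// exprn_ge0 ?powR_ge0.
by apply: ge0_ler_powR; rewrite ?nnegrE ?(ltW p0)// exprn_ge0 ?powR_ge0.
Qed.

Lemma powR_scale2 (R : realType) (p x : R) (m : nat) : 0 < p -> 0 <= x ->
  x `^ p = 2 ^+ m * (x / (2 `^ p^-1) ^+ m) `^ p.
Proof.
move=> p0 x0; have r0 : 0 < (2 `^ p^-1) ^+ m :> R by rewrite exprn_gt0 ?powR_gt0.
rewrite -(@powR2V_powR _ p)// -powRM ?divr_ge0// ?ltW//.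
by rewrite mulrCA divff ?mulr1// gt_eqF.
Qed.

(** With u = x / r^m in [0, 1], dividing by 2^m turns this into u^s <= u^p. *)
Lemma truncated_power_le (R : realType) (p x : R) (s m : nat) :
  0 < p <= s%:R -> 0 <= x <= (2 `^ p^-1) ^+ m ->
  x ^+ s * (2 / (2 `^ p^-1) ^+ s) ^+ m <= x `^ p.
Proof.
move=> /andP[p0 ps] /andP[x0 xm].
set r := 2 `^ p^-1 in xm *; have r0 : 0 < r ^+ m by rewrite exprn_gt0 ?powR_gt0.
rewrite (@powR_scale2 _ p x m)// -/r.
have -> : x ^+ s * (2 / r ^+ s) ^+ m = 2 ^+ m * (x / r ^+ m) ^+ s.
  by rewrite !expr_div_n mulrCA -!exprM mulnC.
rewrite ler_pM2l ?exprn_gt0// -powR_mulrn ?divr_ge0 ?(ltW r0)//.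
have [->|xn0] := eqVneq x 0; first by rewrite mul0r !powR0// gt_eqF// (lt_le_trans p0).
apply: ger_powR => //; rewrite ler_pdivrMr// mul1r xm andbT divr_gt0//.
by rewrite lt_neqAle eq_sym xn0.
Qed.

(** The counterpart above the truncation level: with u = x / r^m >= 1 it reads u <= u^p. *)
Lemma tail_power_le (R : realType) (p x : R) (m : nat) :
  1 <= p -> (2 `^ p^-1) ^+ m < x ->
  x * (2 / 2 `^ p^-1) ^+ m <= x `^ p.
Proof.
move=> p1; have p0 := lt_le_trans ltr01 p1.
set r := 2 `^ p^-1; have r0 : 0 < r ^+ m by rewrite exprn_gt0 ?powR_gt0.
move=> mx; have x0 := lt_trans r0 mx.
rewrite (@powR_scale2 _ p x m) ?(ltW x0)// -/r expr_div_n mulrCA.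
rewrite ler_pM2l ?exprn_gt0//.
by apply: le1r_powR => //; rewrite ler_pdivlMr ?mul1r ?ltW.
Qed.

(* Every [j > 0] lies in some [[2^n, 2^(n+1))], where [j^(1/p) >= r^n]. *)
Lemma cvg0_of_dyadic_bound (R : realType) (p : R) (D v : nat -> R) : 0 < p ->
  v @ \oo --> (0 : R) ->
  (\forall n \near \oo, forall j, (j <= 2 ^ n)%N ->
    `|D j| <= (2 `^ p^-1) ^+ n * v n) ->
  (D j / j%:R `^ p^-1) @[j --> \oo] --> (0 : R).
Proof.
move=> p0 v0 [N _ Dv]; set r := 2 `^ p^-1 in Dv.
have r0 : 0 < r by rewrite powR_gt0.
apply/cvgr0Pnorm_le => e e0.
(* The bound on [D j] is taken at scale n+1 while j^(1/p) is compared with r^n; dividing by r pays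
   for the lost scale. *)
have /cvgr0Pnorm_le/(_ (e / r))[|M _ vM] := v0; first exact: divr_gt0.
exists (2 ^ (N + M))%N => // j /= jNM.
have j0 : (0 < j)%N by apply: leq_trans jNM; rewrite expn_gt0.
pose n := trunc_log 2 j.
have nj : (2 ^ n <= j)%N by apply: trunc_logP.
have jn : (j < 2 ^ n.+1)%N by apply: trunc_log_ltn.
have NMn : (N + M <= n)%N by rewrite trunc_log_max.
have jr : r ^+ n <= j%:R `^ p^-1.
  rewrite /r -powR_mulrn ?powR_ge0// -powRrM mulrC powRrM powR_mulrn//.
  by rewrite ge0_ler_powR ?nnegrE ?invr_ge0 ?(ltW p0)// -natrX ler_nat.
have rn0 : 0 < r ^+ n by rewrite exprn_gt0.
have jp0 : 0 < j%:R `^ p^-1 :> R by exact: lt_le_trans jr.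
rewrite normrM normfV (ger0_norm (ltW jp0)) ler_pdivrMr//.
apply: (le_trans (Dv n.+1 _ j (ltnW jn))); first by rewrite /=; lia.
have /= vn := vM n.+1 ltac:(rewrite /=; lia).
apply: (@le_trans _ _ (r ^+ n.+1 * (e / r))).
  by rewrite ler_pM2l ?exprn_gt0// (le_trans (ler_norm _)).
have -> : r ^+ n.+1 * (e / r) = e * r ^+ n by rewrite exprS; field; rewrite gt_eqF.
by rewrite ler_pM2l.
Qed.

(** * Expectation, independence and variance *)

Section expectation_tools.
Local Open Scope ereal_scope.
Context d (T : measurableType d) (R : realType) (P : probability T R).
Implicit Types (f g : T -> R) (X : nat -> {RV P >-> R}).

Lemma ge0_expectation_sum (I : Type) (s : seq I) (f : I -> T -> R) :
  (forall i, measurable_fun setT (f i)) -> (forall i w, (0 <= f i w)%R) ->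
  'E_P[fun w => (\sum_(i <- s) f i w)%R] = \sum_(i <- s) 'E_P[f i].
Proof.
move=> mf f0; rewrite unlock.
under eq_integral do rewrite -sumEFin.
rewrite ge0_integral_sum//.
- by move=> i; exact/measurable_EFinP.
- by move=> i w _; rewrite lee_fin.
Qed.

Lemma ge0_expectationD f g : measurable_fun setT f -> measurable_fun setT g ->
  (forall w, (0 <= f w)%R) -> (forall w, (0 <= g w)%R) ->
  'E_P[fun w => (f w + g w)%R] = 'E_P[f] + 'E_P[g].
Proof.
move=> mf mg f0 g0; rewrite unlock; under eq_integral do rewrite EFinD.
rewrite ge0_integralD//; try exact/measurable_EFinP.
- by move=> w _; rewrite lee_fin.
- by move=> w _; rewrite lee_fin.
Qed.

Lemma ge0_expectationZl (c : R) f : (0 <= c)%R ->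
  measurable_fun setT f -> (forall w, (0 <= f w)%R) ->
  'E_P[fun w => (c * f w)%R] = c%:E * 'E_P[f].
Proof.
move=> c0 mf f0; rewrite unlock.
under eq_integral do rewrite EFinM.
by rewrite ge0_integralZl_EFin//; [move=> w _; rewrite lee_fin|exact/measurable_EFinP].
Qed.

Lemma ge0_expectation_le f g : measurable_fun setT f -> measurable_fun setT g ->
  (forall w, 0 <= f w <= g w)%R -> 'E_P[f] <= 'E_P[g].
Proof.
move=> mf mg fg; apply: expectation_le => // [w|w|].
- by have /andP[] := fg w.
- by have /andP[/le_trans h /h] := fg w.
- by apply: aeW => w; have /andP[] := fg w.
Qed.

(** By monotone convergence the series of the [f n] has finite expectation, so it converges almost
    surely and its terms tend to 0. This stands in for Markov's inequality followed by
    Borel-Cantelli. *)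
Lemma ae_cvg0_of_summable (f : nat -> T -> R) (C : R) :
  (forall n, measurable_fun setT (f n)) -> (forall n w, (0 <= f n w)%R) ->
  (forall N, \sum_(n < N) 'E_P[f n] <= C%:E) ->
  {ae P, forall w, f n w @[n --> \oo] --> (0 : R)%R}.
Proof.
move=> mf f0 fC.
pose g w := \sum_(n <oo) (f n w)%:E.
have mg : measurable_fun setT g.
  by apply: ge0_emeasurable_sum => // n; [move=> w _ _; rewrite lee_fin|move=> _; exact/measurable_EFinP].
have g0 w : 0 <= g w by apply: nneseries_ge0 => n _ _; rewrite lee_fin.
have ig : P.-integrable setT g.
  apply/integrableP; split => //.
  under eq_integral do rewrite gee0_abs//.
  rewrite integral_nneseries//; last 2 first.
  - by move=> n; exact/measurable_EFinP.
  - by move=> n w _; rewrite lee_fin.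
  apply: (@le_lt_trans _ _ C%:E); last exact: ltry.
  apply: lime_le; first by apply: is_cvg_nneseries => n _ _; apply: integral_ge0 => w _; rewrite lee_fin.
  apply: nearW => N; rewrite big_mkord; have := fC N.
  by rewrite expectation.unlock.
apply: filterS (integrable_ae measurableT ig) => w /(_ Logic.I) gw.
apply: cvg_series_cvg_0; apply: nondecreasing_is_cvgn.
  by apply: nondecreasing_series => n *; exact: f0.
exists (fine (g w)) => _ [N _ <-].
rewrite -lee_fin fineK// /series/= -sumEFin.
by apply: nneseries_lim_ge => n _ _; rewrite lee_fin.
Qed.

Lemma expectation_comp_identical X (phi : R -> R) i j :
  identically_distributed X -> measurable_fun setT phi ->
  (forall x, (0 <= phi x)%R) -> 'E_P[phi \o X i] = 'E_P[phi \o X j].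
Proof.
move=> XI mphi phi0; rewrite unlock.
rewrite -[LHS](@ge0_integral_distribution _ _ _ _ _ P (X i) (EFin \o phi))//;
  last exact/measurable_EFinP.
rewrite -[RHS](@ge0_integral_distribution _ _ _ _ _ P (X j) (EFin \o phi))//;
  last exact/measurable_EFinP.
by apply: eq_measure_integral => A mA _; exact: XI.
Qed.

(** Independence says that the law of (X, Y) and the product of the laws agree on rectangles, hence
    everywhere; Tonelli's theorem then separates the factors. *)
Lemma expectation_mul_independent (X Y : {RV P >-> R}) (phi psi : R -> R) :
  independent_RV X Y -> measurable_fun setT phi -> measurable_fun setT psi ->
  (forall x, (0 <= phi x)%R) -> (forall x, (0 <= psi x)%R) ->
  'E_P[fun w => (phi (X w) * psi (Y w))%R] = 'E_P[phi \o X] * 'E_P[psi \o Y].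
Proof.
move=> XY mphi mpsi phi0 psi0; rewrite unlock.
have mXY : measurable_fun setT (fun w => (X w, Y w)) by exact: measurable_fun_pair.
pose XYm : {mfun T >-> (R * R)%type} := mfun_Sub (mem_set mXY).
have mF : measurable_fun setT (fun z : R * R => (phi z.1 * psi z.2)%R%:E).
  apply/measurable_EFinP; apply: measurable_funM.
    by apply: measurableT_comp => //; exact: measurable_fst.
  by apply: measurableT_comp => //; exact: measurable_snd.
rewrite -[LHS](@ge0_integral_distribution _ _ _ _ _ P XYm
  (fun z => (phi z.1 * psi z.2)%R%:E))//; last first.
  by move=> y; rewrite lee_fin mulr_ge0.
transitivity (\int[distribution P X \x distribution P Y]_z (phi z.1 * psi z.2)%R%:E).
  apply: eq_measure_integral => A mA _; apply/esym.
  by apply: product_measure_unique => // B C mB mC; exact: XY.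
rewrite fubini_tonelli1//=; last by move=> z; rewrite lee_fin mulr_ge0.
rewrite /fubini_F/=.
under eq_integral => x _.
  under eq_integral do rewrite EFinM.
  rewrite ge0_integralZl_EFin//; last 2 first.
  - by move=> y _; rewrite lee_fin.
  - exact/measurable_EFinP.
  rewrite muleC; over.
rewrite /= ge0_integralZl//; last 3 first.
- exact/measurable_EFinP.
- by move=> y _; rewrite lee_fin.
- by apply: integral_ge0 => y _; rewrite lee_fin.
rewrite muleC; congr (_ * _).
  rewrite (@ge0_integral_distribution _ _ _ _ _ P X (EFin \o phi))//.
  exact/measurable_EFinP.
rewrite (@ge0_integral_distribution _ _ _ _ _ P Y (EFin \o psi))//.
exact/measurable_EFinP.
Qed.

Lemma bounded_Lfun f (M r : R) : measurable_fun setT f ->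
  (forall w, `|f w| <= M)%R -> (0 <= r)%R -> f \in Lfun P r%:E.
Proof.
move=> mf fM r0; rewrite inE/=; apply/andP; split; rewrite inE//=.
rewrite /finite_norm unlock poweR_lty//.
have mfr : measurable_fun setT (fun x => `|f x| `^ r)%R.
  by apply: (measurableT_comp (measurable_powR _)) => //; exact: measurableT_comp.
apply: (@le_lt_trans _ _ (\int[P]_x (cst (M `^ r)%:E) x)); last first.
  by rewrite integral_cst//= probability_setT mule1 ltry.
apply: ge0_le_integral => //; first by move=> w _; rewrite lee_fin powR_ge0.
  exact/measurable_EFinP.
move=> w _; rewrite lee_fin ge0_ler_powR// nnegrE//.
exact: le_trans (fM w).
Qed.

(** Bienaymé's identity, by induction: the head is uncorrelated with the sum of the tail. *)
Lemma variance_sum_uncorrelated (I : eqType) (s : seq I) (f : I -> T -> R) :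
  uniq s -> (forall i, f i \in Lfun P 2%:E) ->
  (forall i j, i != j -> covariance P (f i) (f j) = 0) ->
  'V_P[(\sum_(i <- s) f i)%R] = \sum_(i <- s) 'V_P[f i].
Proof.
move=> + f2 fij; elim: s => [|i s IH] /=.
  by rewrite !big_nil => _; rewrite (variance_cst P 0).
move=> /andP[is_ us]; rewrite !big_cons -IH//.
have s2 (t : seq I) : (\sum_(i <- t) f i)%R \in Lfun P 2%:E.
  elim: t => [|j t IHt]; first by rewrite big_nil (Lfun_cst P 0%R 2%R).
  by rewrite big_cons rpredD ?lee1n.
rewrite varianceD//.
suff -> : covariance P (f i) (\sum_(j <- s) f j)%R = 0 by rewrite mule0 adde0.
elim: s is_ {us IH} => [|j s IH].
  by rewrite big_nil covariance_cst_r.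
rewrite inE negb_or => /andP[ij is_].
by rewrite big_cons covarianceDr// fij// IH// adde0.
Qed.

Lemma variance_le_sqr f : f \in Lfun P 2%:E -> 'V_P[f] <= 'E_P[fun w => (f w ^+ 2)%R].
Proof.
move=> f2; rewrite varianceE// leeBlDr; last first.
  rewrite fin_numX// expectation_fin_num//.
  by apply: Lfun_subset12 => //; exact: fin_num_measure.
by rewrite leeDl// sqre_ge0.
Qed.

(** The left side is a variance, so only covariances of pairs enter. Both directions of the theorem
    use pairwise independence through this bound: with truncations for the direct part, with
    indicators depending on i for the converse. *)
Lemma expectation_sqr_centered_sum_le X (phi : nat -> R -> R) (M : R) (s : seq nat) :
  pairwise_independent X -> (forall i, measurable_fun setT (phi i)) ->
  (forall i x, 0 <= phi i x <= M)%R -> uniq s ->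
  'E_P[fun w => ((\sum_(i <- s) (phi i (X i w) - fine 'E_P[phi i \o X i])) ^+ 2)%R]
    <= \sum_(i <- s) 'E_P[fun w => (phi i (X i w) ^+ 2)%R].
Proof.
move=> XI mphi phiM us.
pose f i := phi i \o X i.
have mf i : measurable_fun setT (f i) by apply: measurableT_comp.
have f2 i : f i \in Lfun P 2%:E.
  apply: (@bounded_Lfun _ M) => // w.
  by have /andP[p0 pM] := phiM i (X i w); rewrite ger0_norm.
have f1 i : f i \in Lfun P 1 by apply: Lfun_subset12 => //; exact: fin_num_measure.
have fij i j : i != j -> covariance P (f i) (f j) = 0.
  move=> ij; rewrite covarianceE//; last exact: Lfun2_mul_Lfun1.
  rewrite [X in X - _](expectation_mul_independent _ _ _ _ (XI i j ij))//.
  - by rewrite subee// fin_numM//; apply: expectation_fin_num; exact: f1.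
  - by move=> x; have /andP[] := phiM i x.
  - by move=> x; have /andP[] := phiM j x.
rewrite [leLHS](_ : _ = 'V_P[(\sum_(i <- s) f i)%R]).
  rewrite variance_sum_uncorrelated//; apply: lee_sum => i _.
  exact: variance_le_sqr.
have Ef : 'E_P[(\sum_(i <- s) f i)%R] = \sum_(i <- s) 'E_P[f i].
  rewrite -ge0_expectation_sum//; last first.
    by move=> i w; have /andP[] := phiM i (X i w).
  by congr expectation; apply/funext => w; rewrite fct_sumE.
rewrite /variance [in RHS]unlock; congr expectation; apply/funext => w /=.
rewrite expr2 !fctE.
suff -> : (\sum_(i <- s) (phi i (X i w) - fine 'E_P[phi i \o X i]))%R =
   ((\sum_(i <- s) f i)%R w - fine 'E_P[(\sum_(i <- s) f i)%R])%R by [].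
by rewrite Ef fct_sumE sumrB -sum_fine// => i _; exact: expectation_fin_num.
Qed.

End expectation_tools.

(** * Truncated moments *)

(** Negative values are also sent to 0, so that the function is nonnegative on the whole line, as
    the lemmas on expectations of compositions require. *)
Definition truncation {R : realType} (a x : R) : R := if 0 <= x <= a then x else 0.

Section truncation_lemmas.
Context {R : realType}.
Implicit Types a x : R.

Lemma truncation_ge0 a x : 0 <= truncation a x.
Proof. by rewrite /truncation; case: ifP => // /andP[]. Qed.

Lemma truncation_le a x : 0 <= a -> truncation a x <= a.
Proof. by rewrite /truncation; case: ifP => // /andP[]. Qed.

Lemma truncation_le_id a x : 0 <= x -> truncation a x <= x.
Proof. by rewrite /truncation; case: ifP. Qed.

Lemma truncation_id a x : 0 <= x <= a -> truncation a x = x.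
Proof. by rewrite /truncation => ->. Qed.

Lemma measurable_truncation a : measurable_fun setT (truncation a).
Proof.
rewrite (_ : truncation a = (id \_ `[0, a])%R).
  by apply/(measurable_restrictT _ _).1 => //; exact: measurable_id.
apply/funext => x; rewrite patchE /truncation.
have -> : (x \in `[0, a]%classic) = (0 <= x <= a).
  by apply/idP/idP; rewrite inE/= in_itv.
by [].
Qed.

End truncation_lemmas.

Section moment_sums.
Local Open Scope ereal_scope.
Context d (T : measurableType d) (R : realType) (P : probability T R).
Context (X : nat -> {RV P >-> R}) (p : R).
Local Notation r := (2 `^ p^-1 : R)%R.
Hypothesis X_ident : identically_distributed X.
Hypothesis X_ge0 : forall i w, (0 <= X i w)%R.
Hypothesis p_gt0 : (0 < p)%R.
Hypothesis X_moment : 'E_P[fun w => (X 0%N w `^ p)%R] < +oo.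

Let K := fine 'E_P[fun w => (X 0%N w `^ p)%R].

Let KE : 'E_P[fun w => (X 0%N w `^ p)%R] = K%:E.
Proof. by rewrite fineK// ge0_fin_numE// expectation_ge0// => w; exact: powR_ge0. Qed.

Let mXp : measurable_fun setT (fun w => X 0%N w `^ p)%R.
Proof. by apply: (measurableT_comp (measurable_powR _)). Qed.

Let r0 (n : nat) : (0 < r ^+ n)%R.
Proof. by rewrite exprn_gt0// powR_gt0. Qed.

(** The ratio is 2^(1 - s/p), with negative exponent. *)
Lemma pow2_ratio_lt1 (s : nat) : (p < s%:R)%R -> (0 < 2 / r ^+ s < 1)%R.
Proof.
move=> ps; rewrite divr_gt0//= ltr_pdivrMr// mul1r.
rewrite -powR_mulrn ?powR_ge0// -powRrM.
have -> : (p^-1 * s%:R = 1 + (p^-1 * s%:R - 1))%R by ring.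
rewrite powRD ?pnatr_eq0 ?implybT// powRr1// ltr_pMr// powR_gt1 ?ltr1n//.
by rewrite subr_gt0 mulrC ltr_pdivlMr ?mul1r.
Qed.

(** Under the expectation, the sum is a geometric series starting at the first m with X <= r^m, and
    each of its terms is at most X^p by [truncated_power_le]. *)
Lemma sum_truncated_moment_le (s N : nat) : (p < s%:R)%R ->
  \sum_(m < N) ((2 / r ^+ s) ^+ m)%:E *
      'E_P[fun w => (truncation (r ^+ m) (X 0%N w) ^+ s)%R]
    <= (K / (1 - 2 / r ^+ s))%:E.
Proof.
move=> ps; have /andP[q0 q1] := pow2_ratio_lt1 s ps.
set q := (2 / _)%R in q0 q1 *.
have s0 : (0 < s)%N by rewrite -(ltr_nat R) (lt_trans p_gt0).
have mt m : measurable_fun setT (fun w => truncation (r ^+ m) (X 0%N w) ^+ s)%R.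
  by apply: measurable_funX; apply: measurableT_comp => //; exact: measurable_truncation.
have t0 m w : (0 <= truncation (r ^+ m) (X 0%N w) ^+ s)%R by rewrite exprn_ge0// truncation_ge0.
under eq_bigr => m _ do rewrite -ge0_expectationZl ?exprn_ge0 ?(ltW q0)//.
rewrite -[leLHS]ge0_expectation_sum; last 2 first.
- by move=> m; exact: measurable_funM.
- by move=> m w; rewrite mulr_ge0// exprn_ge0// ltW.
apply: (@le_trans _ _ 'E_P[fun w => ((1 - q)^-1 * (X 0%N w `^ p))%R]).
  apply: ge0_expectation_le.
  - by apply: measurable_sum => m; exact: measurable_funM.
  - by apply: measurable_funM; [exact: measurable_cst|exact: mXp].
  move=> w; rewrite sumr_ge0/=; last by move=> m _; rewrite mulr_ge0// exprn_ge0// ltW.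
  rewrite -(@ler_pM2l _ (1 - q)%R) ?subr_gt0// mulrA mulfV ?gt_eqF ?subr_gt0// mul1r.
  have -> : (\sum_(m < N) q ^+ m * truncation (r ^+ m) (X 0%N w) ^+ s =
    \sum_(m < N) q ^+ m * (if X 0%N w <= r ^+ m then X 0%N w ^+ s else 0))%R.
    apply: eq_bigr => m _; congr (_ * _)%R; rewrite /truncation X_ge0/=.
    by case: ifP => // _; rewrite expr0n gtn_eqF.
  apply: (geometric_tail_le _ _ _ _ (fun m => X 0%N w <= r ^+ m)%R);
    rewrite ?(ltW q0) ?(ltW q1) ?exprn_ge0 ?powR_ge0//.
    move=> m /le_trans; apply; rewrite exprS ler_peMl ?(ltW (r0 m))//.
    by rewrite ltW// powR_gt1// ?invr_gt0// ltr1n.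
  by move=> m xm; apply: truncated_power_le; rewrite ?p_gt0 ?X_ge0 ?(ltW ps).
rewrite ge0_expectationZl ?invr_ge0 ?subr_ge0 ?(ltW q1)//; last by move=> w; exact: powR_ge0.
by rewrite KE -EFinM mulrC.
Qed.

(** The expected number of i < 2^n with X_i > r^n is 2^n P(X^p > 2^n), and these numbers sum to at
    most 2 E X^p. *)
Lemma ae_eventually_le_pow2 :
  {ae P, forall w, \forall n \near \oo, forall i, (i < 2 ^ n)%N ->
    (X i w <= r ^+ n)%R}.
Proof.
pose tail n x : R := (\1_`]r ^+ n, +oo[ x)%R.
pose f n w := (\sum_(i < 2 ^ n) tail n (X i w))%R.
have mtail n : measurable_fun setT (tail n) by exact: measurable_indic.
have tail0 n x : (0 <= tail n x)%R by rewrite /tail indicE.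
have mf n : measurable_fun setT (f n).
  by apply: measurable_sum => i; exact: measurableT_comp.
have f0 n w : (0 <= f n w)%R by apply: sumr_ge0.
have tailE n x : tail n x = (r ^+ n < x)%R%:R.
  by rewrite /tail indicE mem_setE in_itv/= andbT.
have Ef n : 'E_P[f n] = 'E_P[fun w => (2 ^+ n * tail n (X 0%N w))%R].
  rewrite ge0_expectation_sum//; last by move=> i; exact: measurableT_comp.
  rewrite (eq_bigr (fun=> 'E_P[tail n \o X 0%N])); last first.
    by move=> i _; apply: expectation_comp_identical.
  rewrite ge0_expectationZl//; last exact: measurableT_comp.
  by rewrite sumr_const card_ord -natrX -[RHS]/(_%:R%:E * _) mule_natl.
have fK N : \sum_(n < N) 'E_P[f n] <= (2 * K)%:E.
  under eq_bigr do rewrite Ef.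
  have mt n : measurable_fun setT (fun w => 2 ^+ n * tail n (X 0%N w))%R.
    by apply: measurable_funM => //; exact: measurableT_comp.
  rewrite -[leLHS]ge0_expectation_sum//; last first.
    by move=> n w; rewrite mulr_ge0// exprn_ge0.
  apply: (@le_trans _ _ 'E_P[fun w => (2 * (X 0%N w `^ p))%R]).
    apply: ge0_expectation_le.
    - by apply: measurable_sum => m.
    - by apply: measurable_funM; [exact: measurable_cst|exact: mXp].
    move=> w; rewrite sumr_ge0/=; last by move=> m _; rewrite mulr_ge0// exprn_ge0.
    rewrite (eq_bigr (fun m : 'I_N => 2 ^+ m * (2 ^+ m < X 0%N w `^ p)%R%:R)%R).
      by apply: sum_pow2_lt_le; exact: powR_ge0.
    by move=> m _; rewrite tailE ltNge le_pow2_powR// -ltNge.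
  by rewrite ge0_expectationZl// ?KE// => w; exact: powR_ge0.
have := ae_cvg0_of_summable _ _ _ _ _ _ mf f0 fK.
(* [f n w] counts exceedances, so it vanishes as soon as it is below 1. *)
apply: filterS => w /cvgr0Pnorm_lt /(_ 1%R ltr01).
apply: filterS => n; rewrite ger0_norm// => fn1 i i2.
rewrite leNgt; apply/negP => ri.
move: fn1; rewrite ltNge => /negP; apply.
rewrite /f (bigD1 (Ordinal i2))//= tailE ri lerDl; exact: sumr_ge0.
Qed.

End moment_sums.

(** * Nonnegative variables *)

(** The deterministic half of the argument. Chaining costs c 0 plus the sum of the c m, at most
    twice the sum on the right; the upper bound on the full block adds c n, whence the factor 3. *)
Lemma dyadic_deviation_le (R : realDomainType) (x : nat -> R) (y : nat -> nat -> R)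
    (b : R) (c : nat -> R) (n : nat) :
  (forall m i, y m i <= x i) -> (forall i, (i < 2 ^ n)%N -> x i = y n i) ->
  (forall m, 0 <= c m) ->
  (forall m k, (k.+1 * 2 ^ m <= 2 ^ n)%N ->
    - c m <= \sum_(k * 2 ^ m <= i < k.+1 * 2 ^ m) (y m i - b)) ->
  \sum_(0 <= i < 2 ^ n) (y n i - b) <= c n ->
  forall j, (j <= 2 ^ n)%N ->
    `|\sum_(0 <= i < j) (x i - b)| <= 3 * \sum_(m < n.+1) c m.
Proof.
move=> yx xy c0 yc ycn j jn.
have [|L U] := dyadic_chaining _ (fun i => x i - b) c n c0 _ j jn.
  move=> m k kn; apply: (le_trans (yc m k kn)).
  by apply: ler_sum => i _; rewrite lerD2r.
have full : \sum_(0 <= i < 2 ^ n) (x i - b) <= c n.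
  apply: le_trans ycn; rewrite le_eqVlt; apply/orP; left; apply/eqP.
  by apply: eq_big_nat => i /andP[_ /xy ->].
move: full; rewrite (@big_cat_nat _ _ _ j)//= => full.
have S0 : c 0%N + \sum_(m < n) c m <= 2 * \sum_(m < n.+1) c m.
  have Sn : \sum_(m < n) c m <= \sum_(m < n.+1) c m by rewrite big_ord_recr/= lerDl.
  have : c 0%N <= \sum_(m < n.+1) c m by rewrite big_ord_recl/= lerDl sumr_ge0.
  lra.
have Sn : c n <= \sum_(m < n.+1) c m by rewrite big_ord_recr/= lerDr sumr_ge0.
by rewrite ler_norml; apply/andP; split; lra.
Qed.

Section nonnegative_case.
Local Open Scope ereal_scope.
Context d (T : measurableType d) (R : realType) (P : probability T R).
Context (X : nat -> {RV P >-> R}) (p : R).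
Local Notation r := (2 `^ p^-1 : R)%R.
Hypothesis X_ident : identically_distributed X.
Hypothesis X_ge0 : forall i w, (0 <= X i w)%R.
Hypothesis p_gt0 : (0 < p)%R.
Hypothesis X_moment : 'E_P[fun w => (X 0%N w `^ p)%R] < +oo.

Let K := fine 'E_P[fun w => (X 0%N w `^ p)%R].

Let r0 (n : nat) : (0 < r ^+ n)%R.
Proof. by rewrite exprn_gt0// powR_gt0. Qed.

Let r1 : (1 < r)%R.
Proof. by rewrite powR_gt1 ?invr_gt0// ltr1n. Qed.

Let mt m i : measurable_fun setT (truncation (r ^+ m) \o X i).
Proof. by apply: measurableT_comp => //; exact: measurable_truncation. Qed.

Let Et m i : 'E_P[truncation (r ^+ m) \o X i] = 'E_P[truncation (r ^+ m) \o X 0%N].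
Proof.
apply: expectation_comp_identical => //; first exact: measurable_truncation.
by move=> x; exact: truncation_ge0.
Qed.

(** * The case p < 1 *)

Lemma nonneg_partial_sum_cvg0 : (p < 1)%R ->
  {ae P, forall w,
    (partial_sum X n w / n%:R `^ p^-1)%R @[n --> \oo] --> (0 : R)%R}.
Proof.
move=> p1.
pose f n w := ((r ^+ n)^-1 * \sum_(i < 2 ^ n) truncation (r ^+ n) (X i w))%R.
have ms n : measurable_fun setT
    (fun w => \sum_(i < 2 ^ n) truncation (r ^+ n) (X i w))%R.
  by apply: measurable_sum => i; exact: mt.
have s0 n w : (0 <= \sum_(i < 2 ^ n) truncation (r ^+ n) (X i w))%R.
  by apply: sumr_ge0 => i _; exact: truncation_ge0.
have mf n : measurable_fun setT (f n).
  by apply: measurable_funM; [exact: measurable_cst|exact: ms].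
have f0 n w : (0 <= f n w)%R by rewrite mulr_ge0// invr_ge0 ltW.
(* The exponent 1 is kept visible in order to apply [sum_truncated_moment_le] with s = 1 > p. *)
have Ef n : 'E_P[f n] = ((2 / r ^+ 1) ^+ n)%:E *
    'E_P[fun w => (truncation (r ^+ n) (X 0%N w) ^+ 1)%R].
  rewrite ge0_expectationZl ?invr_ge0 ?(ltW (r0 n))//.
  rewrite ge0_expectation_sum; last 2 first.
  - by move=> i; exact: mt.
  - by move=> i w; exact: truncation_ge0.
  rewrite (eq_bigr (fun=> 'E_P[truncation (r ^+ n) \o X 0%N])); last first.
    by move=> i _; exact: Et.
  rewrite sumr_const card_ord -[X in _ * X]mule_natl muleA natrX -EFinM.
  by rewrite expr1 expr_div_n mulrC.
have fK N : \sum_(n < N) 'E_P[f n] <= (K / (1 - 2 / r ^+ 1))%:E.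
  by under eq_bigr do rewrite Ef; apply: sum_truncated_moment_le.
have := ae_cvg0_of_summable _ _ _ _ _ _ mf f0 fK.
have := ae_eventually_le_pow2 _ _ _ _ X p X_ident X_ge0 p_gt0 X_moment.
apply: filterS2 => w Xr fw.
apply: (cvg0_of_dyadic_bound _ p _ (f ^~ w)) => //.
apply: filterS Xr => n Xr j jn.
(* By nonnegativity S_j <= S_(2^n), and [Xr] identifies S_(2^n) with the truncated sum. *)
rewrite ger0_norm; last by apply: sumr_ge0.
rewrite /f mulrA mulfV ?gt_eqF// mul1r /partial_sum.
rewrite [leRHS](eq_bigr (fun i : 'I_(2 ^ n) => X i w)); last first.
  by move=> i _; rewrite truncation_id// X_ge0 Xr.
rewrite -!(big_mkord xpredT (fun i => X i w)) (@big_cat_nat _ _ _ j 0%N (2 ^ n))//=.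
by rewrite lerDl sumr_ge0.
Qed.

(** * The case p >= 1: full and truncated means *)

Let X1_le w : (1 <= p)%R -> (X 0%N w <= 1 + X 0%N w `^ p)%R.
Proof.
move=> p1; have := powR_ge0 (X 0%N w) p; have [X1|X1] := leP (X 0%N w) 1%R; first by lra.
by have := le1r_powR (ltW X1) p1; lra.
Qed.

Let mX i : measurable_fun setT (X i).
Proof. by []. Qed.

Let mXp : measurable_fun setT (fun w => X 0%N w `^ p)%R.
Proof. by apply: (measurableT_comp (measurable_powR _)). Qed.

Lemma nonneg_expectation_fin_num : (1 <= p)%R -> 'E_P[X 0%N] \is a fin_num.
Proof.
move=> p1; rewrite ge0_fin_numE; last exact: expectation_ge0.
apply: (@le_lt_trans _ _ 'E_P[fun w => 1 + X 0%N w `^ p]%R).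
  apply: ge0_expectation_le => //; first exact: measurable_funD.
  by move=> w; rewrite X_ge0 X1_le.
rewrite (ge0_expectationD _ _ _ _ (cst 1%R)) ?expectation_cst ?lte_add_pinfty ?ltry//.
by move=> w; exact: powR_ge0.
Qed.

Let mean m := fine 'E_P[truncation (r ^+ m) \o X 0%N].

Let mean_fin m : 'E_P[truncation (r ^+ m) \o X 0%N] = (mean m)%:E.
Proof.
rewrite fineK// expectation_fin_num//; apply: (bounded_Lfun _ _ _ _ _ (r ^+ m) 1%R) => // w.
by rewrite ger0_norm ?truncation_ge0//= truncation_le// ltW.
Qed.

Let b := fine 'E_P[X 0%N].

Let mean_le m : (1 <= p)%R -> (mean m <= b)%R.
Proof.
move=> p1; rewrite -lee_fin -mean_fin fineK ?nonneg_expectation_fin_num//.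
apply: ge0_expectation_le => // w.
by rewrite truncation_ge0 truncation_le_id.
Qed.

(** The sequence is the expectation of (2/r)^m X on the event X > r^m. By [tail_power_le] the
    integrand is dominated by X^p, and it vanishes at each point once r^m exceeds X. *)
Lemma truncated_mean_cvg : (1 <= p)%R ->
  ((2 / r) ^+ m * (b - mean m))%R @[m --> \oo] --> (0 : R)%R.
Proof.
move=> p1.
have q0 : (0 < 2 / r)%R by rewrite divr_gt0// powR_gt0.
pose g m w := ((2 / r) ^+ m * (X 0%N w - truncation (r ^+ m) (X 0%N w)))%R.
have mXt m : measurable_fun setT (fun w => X 0%N w - truncation (r ^+ m) (X 0%N w))%R.
  by apply: measurable_funB => //; exact: mt.
have Xt0 m w : (0 <= X 0%N w - truncation (r ^+ m) (X 0%N w))%R.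
  by rewrite subr_ge0 truncation_le_id.
have mg m : measurable_fun setT (g m) by apply: measurable_funM.
have g0 m w : (0 <= g m w)%R by rewrite mulr_ge0// exprn_ge0// ltW.
have Eg m : 'E_P[g m] = ((2 / r) ^+ m * (b - mean m))%:E.
  rewrite ge0_expectationZl ?exprn_ge0 ?(ltW q0)// EFinM; congr (_ * _).
  rewrite EFinB -mean_fin fineK ?nonneg_expectation_fin_num//.
  have -> : 'E_P[X 0%N] = (mean m)%:E +
      'E_P[fun w => (X 0%N w - truncation (r ^+ m) (X 0%N w))%R].
    rewrite -mean_fin -ge0_expectationD//; last by move=> w; exact: truncation_ge0.
    by congr expectation; apply/funext => w /=; rewrite addrC subrK.
  by rewrite mean_fin addeAC subee// add0e.
have lim0 w : (EFin \o g ^~ w) @ \oo --> (cst 0 w : \bar R).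
  apply/cvg_EFin; first by apply: nearW.
  apply: cvg_near_cst.
  have rV : (fun m => (r^-1) ^+ m * X 0%N w)%R @ \oo --> (0 * X 0%N w)%R.
    apply: cvgMl; apply: cvg_expr.
    by rewrite ger0_norm ?invr_ge0 ?powR_ge0// invf_lt1// powR_gt0.
  rewrite mul0r in rV; move/cvgr0Pnorm_lt : rV => /(_ 1%R ltr01).
  apply: filterS => m; rewrite ger0_norm; last by rewrite mulr_ge0// exprn_ge0// invr_ge0 powR_ge0.
  rewrite exprVn mulrC ltr_pdivrMr// mul1r => Xr /=.
  by rewrite /g truncation_id ?X_ge0 ?ltW// subrr mulr0.
have iX : P.-integrable setT (fun w => (X 0%N w `^ p)%:E).
  apply/integrableP; split; first exact/measurable_EFinP.
  under eq_integral do rewrite gee0_abs ?lee_fin ?powR_ge0//.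
  by move: X_moment; rewrite expectation.unlock.
have gX m w : `|(g m w)%:E| <= (X 0%N w `^ p)%:E.
  rewrite gee0_abs ?lee_fin// /g; have [Xr|rX] := leP (X 0%N w) (r ^+ m)%R.
    by rewrite truncation_id ?X_ge0// subrr mulr0 powR_ge0.
  rewrite /truncation [X in _ && X]leNgt rX andbF subr0 mulrC.
  exact: tail_power_le.
have := @dominated_cvg _ _ _ P setT measurableT (fun m w => (g m w)%:E) (cst 0)
  (fun w => (X 0%N w `^ p)%:E).
have -> : (fun m => \int[P]_w (g m w)%:E) = EFin \o (fun m => (2 / r) ^+ m * (b - mean m))%R.
  by apply/funext => m /=; rewrite -Eg unlock.
rewrite integral0 => H.
suff /fine_cvg : EFin \o (fun m => (2 / r) ^+ m * (b - mean m))%R @ \oo --> 0%:E by [].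
apply: H => [m|w _|w _||m w _] //; first exact/measurable_EFinP.
exact: lim0.
Qed.

(** * The case 1 <= p < 2: energy of the dyadic blocks *)

Hypothesis X_indep : pairwise_independent X.
Hypothesis p_lt2 : (p < 2)%R.

Let q : R := (2 / r ^+ 2)%R.

Let q01 : (0 < q < 1)%R.
Proof. exact: pow2_ratio_lt1. Qed.

(* A fourth root leaves room both for the union over the scales [m <= n] in
   [block_energy] and for summing over [n]. *)
Let t : R := Num.sqrt (Num.sqrt q).

Let t4 : (t ^+ 2 ^+ 2 = q)%R.
Proof. by rewrite !sqr_sqrtr ?sqrtr_ge0//; have /andP[/ltW] := q01. Qed.

Let t0 : (0 < t)%R.
Proof. by rewrite !sqrtr_gt0; have /andP[] := q01. Qed.

Let t1 : (t < 1)%R.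
Proof.
rewrite -(@expr_lt1 _ 4) ?ltW//.
by rewrite (_ : 4 = 2 * 2)%N// exprM t4; have /andP[] := q01.
Qed.

Let block m k w : R :=
  (\sum_(k * 2 ^ m <= i < k.+1 * 2 ^ m) (truncation (r ^+ m) (X i w) - mean m))%R.

(** The tolerance for a block at scale m inside [0, 2^n); over m <= n the tolerances add up to at
    most r^n / (1 - t). *)
Let scale n m : R := (r ^+ n * t ^+ (n - m))%R.

Let scale_gt0 n m : (0 < scale n m)%R.
Proof. by rewrite mulr_gt0// exprn_gt0. Qed.

(** A sum of squares in place of a maximum: its square root bounds every block at every scale m <=
    n, relative to the tolerance. *)
Let block_energy n w : R :=
  (\sum_(m < n.+1) \sum_(k < 2 ^ (n - m)) (scale n m ^- 2 * block m k w ^+ 2))%R.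

Let mblock m k : measurable_fun setT (block m k).
Proof.
apply: measurable_sum => i; apply: measurable_funB; first exact: mt.
exact: measurable_cst.
Qed.

Let second_moment m : R := fine 'E_P[fun w => (truncation (r ^+ m) (X 0%N w) ^+ 2)%R].

Let second_moment_fin m :
  'E_P[fun w => (truncation (r ^+ m) (X 0%N w) ^+ 2)%R] = (second_moment m)%:E.
Proof.
rewrite fineK// expectation_fin_num//.
apply: (bounded_Lfun _ _ _ _ _ ((r ^+ m) ^+ 2) 1%R) => // [|w].
  by apply: measurable_funX; exact: mt.
rewrite ger0_norm ?exprn_ge0 ?truncation_ge0//.
by rewrite lerXn2r ?nnegrE ?truncation_ge0 ?truncation_le// ltW.
Qed.

Let block_sqr_le m k :
  'E_P[fun w => (block m k w ^+ 2)%R] <= (2 ^+ m * second_moment m)%:E.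
Proof.
have H : pairwise_independent X := X_indep.
have := @expectation_sqr_centered_sum_le _ _ _ P X (fun=> truncation (r ^+ m))
  (r ^+ m)%R (index_iota (k * 2 ^ m) (k.+1 * 2 ^ m)) H.
rewrite (eq_bigr (fun=> (second_moment m)%:E)); last first.
  move=> i _; rewrite -second_moment_fin.
  apply: (expectation_comp_identical _ _ _ _ X (fun x => truncation (r ^+ m) x ^+ 2)%R) => //.
    by apply: measurable_funX; exact: measurable_truncation.
  by move=> x; rewrite exprn_ge0// truncation_ge0.
rewrite sumEFin sumr_const_nat -mulnBl subSnn mul1n -(mulr_natl (second_moment m)) natrX.
move=> sqr_le; apply: le_trans (sqr_le _ _ (iota_uniq _ _)).
- rewrite le_eqVlt; apply/orP; left; apply/eqP; congr expectation.
  apply/funext => w; congr (_ ^+ 2)%R; apply: eq_bigr => i _.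
  by congr (_ - _)%R; rewrite /mean -(Et m i).
- by move=> _; exact: measurable_truncation.
- by move=> _ x; rewrite truncation_ge0 truncation_le// ltW.
Qed.

Let energy_ge0 n w : (0 <= block_energy n w)%R.
Proof.
apply: sumr_ge0 => m _; apply: sumr_ge0 => k _.
by rewrite mulr_ge0 ?sqr_ge0// invr_ge0 exprn_ge0// ltW.
Qed.

Let menergy n : measurable_fun setT (block_energy n).
Proof.
apply: measurable_sum => m; apply: measurable_sum => k.
by apply: measurable_funM; [exact: measurable_cst|exact: measurable_funX].
Qed.

(** The 2^(n-m) blocks at scale m contribute at most 2^n times the truncated second moment. Since
    2^n / r^(2n) = q^n = q^m t^(4(n-m)), division by the squared tolerance leaves q^m t^(2(n-m)). *)
Let energy_le n : 'E_P[block_energy n] <=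
  (\sum_(m < n.+1) (q ^+ m * second_moment m) * (t ^+ 2) ^+ (n - m))%:E.
Proof.
have mterm m k : measurable_fun setT (fun w => scale n m ^- 2 * block m k w ^+ 2)%R.
  by apply: measurable_funM; [exact: measurable_cst|exact: measurable_funX].
have s0 m : (0 <= scale n m ^- 2)%R by rewrite invr_ge0 exprn_ge0// ltW.
have term0 m k w : (0 <= scale n m ^- 2 * block m k w ^+ 2)%R.
  by rewrite mulr_ge0 ?sqr_ge0.
rewrite ge0_expectation_sum; last 2 first.
- by move=> m; exact: measurable_sum.
- by move=> m w; exact: sumr_ge0.
rewrite -sumEFin; apply: lee_sum => m _.
rewrite ge0_expectation_sum//.
apply: (@le_trans _ _ (\sum_(k < 2 ^ (n - m)) (scale n m ^- 2 * (2 ^+ m * second_moment m))%:E)).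
  apply: lee_sum => k _; rewrite ge0_expectationZl//; last 2 first.
  - exact: measurable_funX.
  - by move=> w; exact: sqr_ge0.
  by rewrite EFinM lee_wpmul2l// lee_fin.
rewrite sumEFin lee_fin sumr_const card_ord -[leLHS]mulr_natl natrX.
have mn : (m <= n)%N by rewrite -ltnS.
have r1' : (r ^+ n != 0)%R by rewrite gt_eqF.
have t1' k : (t ^+ k != 0)%R by rewrite gt_eqF ?exprn_gt0.
have qn : (2 ^+ n = q ^+ n * r ^+ n ^+ 2)%R.
  by rewrite -exprM mulnC exprM -exprMn /q divfK// expf_neq0// gt_eqF ?powR_gt0.
have tn : (q ^+ (n - m) = (t ^+ 2) ^+ (n - m) * (t ^+ (n - m)) ^+ 2)%R.
  by rewrite -t4 -!exprM -exprD; congr (_ ^+ _)%R; lia.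
have qm : (q ^+ n = q ^+ m * q ^+ (n - m))%R by rewrite -exprD subnKC.
have e2 : (2 ^+ (n - m) * 2 ^+ m = 2 ^+ n :> R)%R by rewrite -exprD subnK.
rewrite [leLHS](_ : _ = (2 ^+ (n - m) * 2 ^+ m) * scale n m ^- 2 * second_moment m)%R; last by ring.
rewrite e2 qn qm tn le_eqVlt; apply/orP; left; apply/eqP.
by rewrite /scale; field; rewrite t1' r1'.
Qed.

(** Summation over n removes the geometric kernel in t^2; what remains is the truncated moment sum
    with s = 2 > p. *)
Let energy_cvg0 : {ae P, forall w, block_energy n w @[n --> \oo] --> (0 : R)%R}.
Proof.
have /andP[q0 q1] := q01.
have t2 : (t ^+ 2 < 1)%R by rewrite expr_lt1// ltW.
have v0 m : (0 <= second_moment m)%R.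
  by rewrite fine_ge0// expectation_ge0// => w; exact: sqr_ge0.
apply: (ae_cvg0_of_summable _ _ _ _ _ (K / (1 - q) / (1 - t ^+ 2))%R) => // N.
apply: (@le_trans _ _ (\sum_(n < N)
  (\sum_(m < n.+1) (q ^+ m * second_moment m) * (t ^+ 2) ^+ (n - m))%:E)).
  by apply: lee_sum => n _; exact: energy_le.
rewrite sumEFin lee_fin ler_pdivlMr ?subr_gt0// mulrC.
apply: (le_trans (sum_conv_geometric_le _ _ (fun m => q ^+ m * second_moment m)%R _ _ _)).
- by rewrite exprn_ge0// ltW.
- by move=> m; rewrite mulr_ge0// exprn_ge0// ltW.
rewrite -lee_fin -sumEFin; apply: le_trans (sum_truncated_moment_le _ _ _ _ X p X_ge0 p_gt0 X_moment 2 N p_lt2).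
by apply: lee_sum => m _; rewrite EFinM second_moment_fin.
Qed.

(** For almost every w and large n, truncation at r^n leaves all X_i with i < 2^n unchanged, so
    [dyadic_deviation_le] applies; each [c m] is a fluctuation controlled by the energy plus the
    bias 2^m (b - b_m). *)
Lemma nonneg_centered_sum_cvg0 : (1 <= p)%R ->
  {ae P, forall w, ((partial_sum X n w - n%:R * fine 'E_P[X 0%N]) / n%:R `^ p^-1)%R
    @[n --> \oo] --> (0 : R)%R}.
Proof.
move=> p1.
have rV : (0 <= r^-1 < 1)%R.
  by rewrite invr_ge0 powR_ge0 invf_lt1// powR_gt0.
pose defect m := ((2 / r) ^+ m * (b - mean m))%R.
have defect0 m : (0 <= defect m)%R.
  by rewrite mulr_ge0 ?subr_ge0 ?mean_le// exprn_ge0// divr_ge0// powR_ge0.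
have := ae_eventually_le_pow2 _ _ _ _ X p X_ident X_ge0 p_gt0 X_moment.
apply: filterS2 energy_cvg0 => w Ew Xr.
pose tconv n : R := (\sum_(m < n.+1) defect m * (r^-1) ^+ (n - m))%R.
(* [tconv n] is the total bias divided by r^n, because 2^m / r^n = (2/r)^m r^(-(n-m)). *)
pose v n : R := (3 * (Num.sqrt (block_energy n w) / (1 - t) + tconv n))%R.
have v0 : v @ \oo --> (0 : R)%R.
  rewrite (_ : 0%R = 3 * (Num.sqrt 0 / (1 - t) + 0) :> R)%R; last first.
    by rewrite sqrtr0 mul0r addr0 mulr0.
  apply: cvgMr; apply: cvgD; last first.
    exact: conv_geometric_cvg0 (truncated_mean_cvg p1).
  apply: cvgMl; apply: continuous_cvg => //; exact: sqrt_continuous.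
apply: (cvg0_of_dyadic_bound _ p _ v) => //.
apply: filterS Xr => n Xr j jn.
pose c m : R := (r ^+ n * (Num.sqrt (block_energy n w) * t ^+ (n - m) +
   defect m * (r^-1) ^+ (n - m)))%R.
have c0 m : (0 <= c m)%R.
  rewrite mulr_ge0 ?(ltW (r0 n))// addr_ge0// mulr_ge0 ?sqrtr_ge0 ?exprn_ge0 ?invr_ge0 ?powR_ge0//.
  exact: ltW.
have blockc m k : (m <= n)%N -> (k < 2 ^ (n - m))%N ->
    (`|block m k w| <= scale n m * Num.sqrt (block_energy n w))%R.
  move=> mn kn; rewrite -[X in (X * _)%R](gtr0_norm (scale_gt0 n m)) -sqrtr_sqr -sqrtr_sqr.
  rewrite -sqrtrM ?sqr_ge0// ler_wsqrtr//.
  rewrite -ler_pdivrMl ?exprn_gt0//.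
  have mn' : (m < n.+1)%N by [].
  rewrite /block_energy (bigD1 (Ordinal mn'))//= (bigD1 (Ordinal kn))//=.
  rewrite -addrA lerDl addr_ge0//.
    by apply: sumr_ge0 => i _; rewrite mulr_ge0 ?sqr_ge0// invr_ge0 exprn_ge0// ltW.
  apply: sumr_ge0 => i _; apply: sumr_ge0 => l _.
  by rewrite mulr_ge0 ?sqr_ge0// invr_ge0 exprn_ge0// ltW.
have cE m : (m <= n)%N -> c m = (scale n m * Num.sqrt (block_energy n w) +
    2 ^+ m * (b - mean m))%R.
  move=> mn; rewrite /c /scale /defect -(subnKC mn) addKn exprD.
  by rewrite exprVn expr_div_n; field; rewrite !gt_eqF// r0.
have sum_block m k w' : (\sum_(k * 2 ^ m <= i < k.+1 * 2 ^ m)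
    (truncation (r ^+ m) (X i w') - b) = block m k w' - 2 ^+ m * (b - mean m))%R.
  have e : (2 ^+ m * (b - mean m) =
      \sum_(k * 2 ^ m <= i < k.+1 * 2 ^ m) (b - mean m))%R.
    by rewrite sumr_const_nat -mulnBl subSnn mul1n -natrX mulr_natl.
  by rewrite e /block -sumrB; apply: eq_bigr => i _; ring.
have -> : (partial_sum X j w - j%:R * fine 'E_P[X 0%N] =
    \sum_(0 <= i < j) (X i w - b))%R.
  by rewrite sumrB sumr_const_nat subn0 -(mulr_natl b) big_mkord.
apply: (le_trans (dyadic_deviation_le _ (fun i => X i w)
   (fun m i => truncation (r ^+ m) (X i w)) b c n _ _ _ _ _ _ jn)) => //.
- by move=> m i; exact: truncation_le_id.
- by move=> i i2; rewrite truncation_id// X_ge0 Xr.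
- move=> m k kn; rewrite sum_block.
  have mn : (m <= n)%N.
    by rewrite -(@leq_exp2l 2)// (leq_trans _ kn)// leq_pmull.
  have kn' : (k < 2 ^ (n - m))%N.
    by rewrite -(@leq_pmul2r (2 ^ m)) ?expn_gt0// -expnD subnK.
  have /ler_normlP[] := blockc m k mn kn'; rewrite cE//; lra.
(* For the upper bound, centring at [b] instead of the truncated mean only lowers the sum. *)
- have := sum_block n 0%N w; rewrite mul0n mul1n => ->.
  have /ler_normlP[] := blockc n 0%N (leqnn n) (expn_gt0 _ _).
  have : (0 <= 2 ^+ n * (b - mean n))%R by rewrite mulr_ge0 ?exprn_ge0 ?subr_ge0 ?mean_le.
  rewrite cE//; lra.
rewrite /c -mulr_sumr mulrCA ler_pM2l// /v ler_pM2l// big_split/= lerD2r.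
rewrite -mulr_sumr ler_wpM2l ?sqrtr_ge0//.
rewrite -[leRHS]mul1r ler_pdivlMr ?subr_gt0// mulrC.
exact/sum_geometric_rev_le/ltW.
Qed.

End nonnegative_case.

(** * The converse *)

(** A discrete layer-cake bound, which will turn tail probabilities into a moment. *)
Lemma le_count_below (R : realDomainType) (y : R) (n : nat) : y <= n.+1%:R ->
  y <= 1 + \sum_(k < n) (k.+1%:R < y)%R%:R.
Proof.
elim: n => [|n IH] yn; first by rewrite big_ord0 addr0.
rewrite big_ord_recr/=; have [/IH yS|ny] := leP y n.+1%:R; first by rewrite addr0.
rewrite (eq_bigr (fun=> 1)) => [|k _]; last first.
  by rewrite (le_lt_trans _ ny)// ler_nat ltnS ltnW.
by move: yn; rewrite sumr_const card_ord -!natr1; lra.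
Qed.

Section converse.
Local Open Scope ereal_scope.
Context d (T : measurableType d) (R : realType) (P : probability T R).
Context (X : nat -> {RV P >-> R}).
Hypothesis X_indep : pairwise_independent X.
Hypothesis X_ident : identically_distributed X.

Lemma ae_not_False : ~ {ae P, forall w : T, False}.
Proof.
move=> [A [mA A0 TA]]; have : P setT <= P A by apply: le_measure; rewrite ?inE// => w _; exact: TA.
by rewrite probability_setT A0 lee_fin ler10.
Qed.

(* The second Borel-Cantelli lemma: if the expectations [s n] of the counts were
   unbounded, the count would be close to [s n] in quadratic mean along a sparse
   subsequence, hence unbounded almost surely. *)
Lemma expected_count_bounded (A : nat -> set R) :
  (forall k, measurable (A k)) ->
  {ae P, forall w, \forall k \near \oo, ~ A k (X k w)} ->
  exists C : R, forall n, \sum_(k < n) P (X 0%N @^-1` A k) <= C%:E.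
Proof.
move=> mA XA.
pose phi k x : R := (\1_(A k) x)%R.
have mphi k : measurable_fun setT (phi k) by exact: measurable_indic.
have phi01 k x : (0 <= phi k x <= 1)%R by rewrite /phi indicE ler0n lern1 leq_b1.
have phi0 k x : (0 <= phi k x)%R by have /andP[] := phi01 k x.
have mX k : measurable_fun setT (phi k \o X k) by exact: measurableT_comp.
have mXA k : measurable (X 0%N @^-1` A k).
  by rewrite -[X in measurable X]setTI; exact: measurable_funP.
have Ephi k : 'E_P[phi k \o X k] = P (X 0%N @^-1` A k).
  rewrite (expectation_comp_identical _ _ _ _ X (phi k) k 0%N)//.
  by rewrite -(expectation_indic P (mXA k)).
pose a k : R := fine (P (X 0%N @^-1` A k)).
have aE k : P (X 0%N @^-1` A k) = (a k)%:E by rewrite fineK// fin_num_measure.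
have a0 k : (0 <= a k)%R by rewrite fine_ge0.
pose s n : R := (\sum_(k < n) a k)%R.
pose N n w : R := (\sum_(k < n) phi k (X k w))%R.
have EN n : 'E_P[fun w => ((N n w - s n) ^+ 2)%R] <= (s n)%:E.
  have := expectation_sqr_centered_sum_le _ _ _ P X phi 1%R (index_iota 0 n)
    X_indep mphi phi01 (iota_uniq _ _).
  rewrite big_mkord.
  have -> : (fun w => (\sum_(0 <= i < n) (phi i (X i w) - fine 'E_P[phi i \o X i])) ^+ 2)%R =
     (fun w => (N n w - s n) ^+ 2)%R.
    apply/funext => w; rewrite big_mkord /N /s -sumrB; congr (_ ^+ 2)%R.
    by apply: eq_bigr => k _; rewrite Ephi.
  move/le_trans; apply; rewrite /s -sumEFin; apply: lee_sum => k _.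
  rewrite -aE -Ephi; apply: ge0_expectation_le => //; first by apply: measurable_funX; exact: mX.
  (* Indicators satisfy phi^2 <= phi, so the variance of the count is at most its mean. *)
  by move=> w; rewrite sqr_ge0/= expr2 ler_piMl//; have /andP[] := phi01 k (X k w).
apply: contrapT => /forallNP sC.
have sgt (C : R) : exists n, (C < s n)%R.
  apply: contrapT => /forallNP nC; apply: (sC C) => n.
  under eq_bigr do rewrite aE.
  by rewrite sumEFin lee_fin leNgt; apply/negP; exact: nC.
(* Along [u] the relative quadratic error is at most 1 / s(u j) <= 2^(-j) in expectation, which is
   summable. *)
have [u su] := choice (fun j => sgt (2 ^+ j)%R).
have s0 j : (0 < s (u j))%R by rewrite (lt_trans _ (su j))// exprn_gt0.
pose f j w : R := ((s (u j)) ^- 2 * (N (u j) w - s (u j)) ^+ 2)%R.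
have mN n : measurable_fun setT (fun w => (N n w - s n) ^+ 2)%R.
  apply: measurable_funX; apply: measurable_funB; last exact: measurable_cst.
  by apply: measurable_sum => k; exact: mX.
have mf j : measurable_fun setT (f j) by apply: measurable_funM.
have f0 j w : (0 <= f j w)%R.
  by rewrite mulr_ge0 ?sqr_ge0// invr_ge0 sqr_ge0.
have fC n : \sum_(j < n) 'E_P[f j] <= 2%:E.
  apply: (@le_trans _ _ (\sum_(j < n) ((2^-1) ^+ j)%:E)).
    apply: lee_sum => j _; rewrite ge0_expectationZl//; last 2 first.
    - by rewrite invr_ge0 sqr_ge0.
    - by move=> w; exact: sqr_ge0.
    apply: (@le_trans _ _ ((s (u j) ^- 2)%:E * (s (u j))%:E)).
      by rewrite lee_wpmul2l// lee_fin invr_ge0 sqr_ge0.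
    rewrite -EFinM lee_fin expr2 invfM -mulrA mulVf ?gt_eqF// mulr1 exprVn.
    by rewrite lef_pV2 ?posrE ?exprn_gt0// ltW.
  rewrite sumEFin lee_fin.
  have := @geometric_tail_le R 2^-1 1 1 (fun=> true) n.
  rewrite (eq_bigr (fun m : 'I_n => 2^-1 ^+ m))%R; last by move=> m _; rewrite mulr1.
  move=> geo; have : ((1 - 2^-1) * \sum_(m < n) 2^-1 ^+ m <= 1 :> R)%R; last by move=> {geo} ?; lra.
  apply: geo => // [|m _]; first by apply/andP; split; lra.
  by rewrite mul1r exprn_ile1//; lra.
apply: ae_not_False.
have := ae_cvg0_of_summable _ _ _ _ _ _ mf f0 fC.
apply: filterS2 XA => w [M _ XM] fw.
have NM n : (N n w <= M%:R)%R.
  have [nM|Mn] := leqP n M.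
    apply: (@le_trans _ _ n%:R); last by rewrite ler_nat.
    rewrite -[n in leRHS](card_ord n) -sumr_const; apply: ler_sum => k _.
    by have /andP[] := phi01 k (X k w).
  rewrite /N -(big_mkord xpredT (fun k => phi k (X k w))).
  rewrite (@big_cat_nat _ _ _ M)//=; last exact: ltnW.
  have -> : (\sum_(M <= k < n) phi k (X k w) = 0)%R.
    rewrite big_nat big1// => k /andP[Mk _].
    by rewrite /phi indicE memNset//; exact: XM.
  rewrite addr0.
  rewrite big_mkord -[M in leRHS](card_ord M) -sumr_const; apply: ler_sum => k _.
  by have /andP[] := phi01 k (X k w).
have N0 n : (0 <= N n w)%R by exact: sumr_ge0.
(* The count stays below M, so s >= 2 M forces (N - s)^2 / s^2 >= 1/4; taking j >= 2 M ensures this,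
   as s(u j) > 2^j > j. *)
have quarter : (0 < 4^-1 :> R)%R by rewrite invr_gt0.
move/cvgr0Pnorm_lt : fw => /(_ _ quarter)[J _ fJ].
pose j := maxn J (2 * M)%N.
have := fJ j (leq_maxl _ _); rewrite ger0_norm// /f.
rewrite mulrC ltr_pdivrMr ?exprn_gt0//.
have s2 : (M%:R * 2 <= s (u j))%R.
  rewrite (le_trans _ (ltW (su j)))// -natrM -natrX ler_nat.
  by rewrite (leq_trans _ (ltnW (ltn_expl _ _)))// mulnC leq_maxr.
have := NM (u j); have := N0 (u j); have := s0 j.
nra.
Qed.

(** Borel-Cantelli bounds the sum of P(|X|^p > k + 1) by some C, and the layer-cake bound gives E
    |X|^p <= 1 + C. *)
Lemma moment_of_eventually_le (p : R) :
  {ae P, forall w, \forall k \near \oo, (`|X k w| `^ p <= k.+1%:R)%R} ->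
  'E_P[fun w => (`|X 0%N w| `^ p)%R] < +oo.
Proof.
move=> Xk.
have mpow : measurable_fun setT (fun x : R => `|x| `^ p)%R.
  by apply: (measurableT_comp (measurable_powR _)) => //; exact: measurable_normr.
pose A k := [set x : R | (k.+1%:R < `|x| `^ p)%R].
have mA k : measurable (A k).
  have : measurable_fun setT (fun x : R => (k.+1%:R < `|x| `^ p)%R).
    by apply: measurable_fun_ltr.
  by move=> /(_ measurableT [set true]); rewrite setTI; exact.
have mXA k : measurable (X 0%N @^-1` A k).
  by rewrite -[X in measurable X]setTI; exact: measurable_funP.
have [|C AC] := expected_count_bounded A mA.
  apply: filterS Xk => w; apply: filterS => k Xk; apply/negP.
  by rewrite -leNgt.
pose g w := 1 + \sum_(k <oo) (\1_(X 0%N @^-1` A k) w)%:E : \bar R.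
have Xg w : (`|X 0%N w| `^ p)%:E <= g w.
  have y0 := powR_ge0 `|X 0%N w| p.
  have := le_count_below _ (`|X 0%N w| `^ p)%R (Num.truncn (`|X 0%N w| `^ p)%R).
  move=> /(_ (ltW (truncnS_gt _))); rewrite -lee_fin => /le_trans; apply.
  rewrite EFinD leeD2l// -sumEFin -(big_mkord xpredT (fun k => ((k.+1%:R < `|X 0%N w| `^ p)%R%:R)%:E)).
  apply: le_trans (nneseries_lim_ge _ _); last by move=> k _ _; rewrite lee_fin.
  apply: lee_sum => k _; rewrite lee_fin indicE.
  case: ltP => // XA; rewrite mem_set//.
have mind k : measurable_fun setT (fun w => (\1_(X 0%N @^-1` A k) w)%:E : \bar R).
  exact/measurable_EFinP/measurable_indic.
have msum : measurable_fun setT (fun w => \sum_(k <oo) (\1_(X 0%N @^-1` A k) w)%:E : \bar R).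
  by apply: ge0_emeasurable_sum => // k w _ _; rewrite lee_fin.
rewrite unlock; apply: (@le_lt_trans _ _ (\int[P]_w g w)).
  apply: ge0_le_integral => //.
  - by apply/measurable_EFinP; apply: (measurableT_comp mpow).
  - by apply: emeasurable_funD => //; exact: measurable_cst.
rewrite ge0_integralD//; last first.
  by move=> w _; apply: nneseries_ge0 => k _ _; rewrite lee_fin.
rewrite integral_cst//= probability_setT mule1 integral_nneseries//.
apply: (@le_lt_trans _ _ (1 + C%:E)); last by rewrite -EFinD ltry.
rewrite leeD2l//; apply: lime_le.
  by apply: is_cvg_nneseries => k _ _; apply: integral_ge0 => w _; rewrite lee_fin.
apply: nearW => n; rewrite big_mkord; apply: le_trans (AC n).
by apply: lee_sum => k _; rewrite integral_indic// setIT.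
Qed.

(** With D_n the centred sum, x_k = D_(k+1) - D_k + c, and eventually each of the three terms is at
    most (k+1)^(1/p) / 4 in absolute value. *)
Lemma eventually_le_of_cvg0 (p c : R) (x : nat -> R) : (0 < p)%R ->
  (((\sum_(k < n) x k - n%:R * c) / n%:R `^ p^-1) @[n --> \oo] --> (0 : R))%R ->
  \forall k \near \oo, (`|x k| `^ p <= k.+1%:R)%R.
Proof.
move=> p0 /cvgr0Pnorm_le/(_ 4^-1%R) [|N _ HN]; first by rewrite invr_gt0.
have [M cM] : exists M : nat, ((4 * `|c|) `^ p <= M%:R)%R.
  exists (Num.truncn ((4 * `|c|) `^ p)).+1; exact/ltW/truncnS_gt.
exists (N + M).+1 => // k /= Nk.
pose D n : R := (\sum_(i < n) x i - n%:R * c)%R.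
pose h (n : nat) : R := (n%:R `^ p^-1)%R.
have h0 n : (0 < n)%N -> (0 < h n)%R by move=> n0; rewrite powR_gt0// ltr0n.
have hh : (h k <= h k.+1)%R.
  by rewrite ge0_ler_powR ?nnegrE// ?ler_nat// invr_ge0 ltW.
have k0 : (0 < k)%N by lia.
have Dk n : (N <= n)%N -> (0 < n)%N -> (`|D n| <= 4^-1 * h n)%R.
  move=> Nn n0; have := HN n Nn.
  by rewrite normrM normfV [X in (_ / X)%R]ger0_norm ?powR_ge0// ler_pdivrMr ?h0.
have ck : (4 * `|c| <= h k.+1)%R.
  have -> : (4 * `|c| = ((4 * `|c|) `^ p) `^ p^-1)%R.
    by rewrite -powRrM mulfV ?gt_eqF// powRr1// mulr_ge0.
  rewrite ge0_ler_powR ?nnegrE ?powR_ge0 ?invr_ge0 ?(ltW p0)//.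
  by rewrite (le_trans cM)// ler_nat; lia.
have xk : (`|x k| <= h k.+1)%R.
  have -> : (x k = D k.+1 - D k + c)%R by rewrite /D big_ord_recr/= -natr1; ring.
  rewrite (le_trans (ler_normD _ _))// (le_trans (lerD (ler_normB _ _) (lexx _)))//.
  have := Dk k.+1 ltac:(lia) isT; have := Dk k ltac:(lia) k0; have := h0 k.+1 isT; lra.
have -> : (k.+1%:R = h k.+1 `^ p :> R)%R.
  by rewrite /h -powRrM mulVf ?gt_eqF// powRr1.
by rewrite ge0_ler_powR ?nnegrE ?(ltW p0)// powR_ge0.
Qed.

End converse.

(** * Positive and negative parts *)

Section composition.
Context d (T : measurableType d) (R : realType) (P : probability T R).
Context (X : nat -> {RV P >-> R}) (phi : R -> R).
Hypothesis mphi : measurable_fun setT phi.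

Lemma measurable_comp_RV i : measurable_fun setT (phi \o X i).
Proof. exact: measurableT_comp. Qed.

(** Bundled as random variables so that the nonnegative case applies to positive and negative
    parts. *)
Definition comp_RV i : {RV P >-> R} := mfun_Sub (mem_set (measurable_comp_RV i)).

Lemma pairwise_independent_comp :
  pairwise_independent X -> pairwise_independent comp_RV.
Proof.
move=> XI i j ij A B mA mB; apply: (XI i j ij (phi @^-1` A) (phi @^-1` B)).
- by rewrite -[X in measurable X]setTI; exact: mphi.
- by rewrite -[X in measurable X]setTI; exact: mphi.
Qed.

Lemma identically_distributed_comp :
  identically_distributed X -> identically_distributed comp_RV.
Proof.
move=> XI i j A mA; apply: (XI i j (phi @^-1` A)).
by rewrite -[X in measurable X]setTI; exact: mphi.
Qed.

End composition.

Lemma cvg0_sub (R : realType) (c a b : nat -> R) :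
  (forall n, c n = a n - b n) -> a @ \oo --> (0 : R) -> b @ \oo --> (0 : R) ->
  c @ \oo --> (0 : R).
Proof.
move=> cE a0 b0; rewrite (_ : c = (fun n => a n - b n)); last exact/funext.
by rewrite -(subr0 0); apply: cvgB.
Qed.

Section parts.
Context d (T : measurableType d) (R : realType) (P : probability T R).
Context (X : nat -> {RV P >-> R}) (p : R).
Hypothesis X_indep : pairwise_independent X.
Hypothesis X_ident : identically_distributed X.
Hypothesis p_gt0 : 0 < p.
Hypothesis p_lt2 : p < 2.
Hypothesis X_moment : ('E_P[fun w => (`|X 0%N w| `^ p)%R] < +oo)%E.

Let mpos : measurable_fun setT (fun x : R => Num.max x 0).
Proof. by apply: measurable_maxr; [exact: measurable_id|exact: measurable_cst]. Qed.

Let mneg : measurable_fun setT (fun x : R => Num.max (- x) 0).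
Proof.
apply: measurable_maxr; last exact: measurable_cst.
apply: measurable_funN; exact: measurable_id.
Qed.

Let Xp := comp_RV _ _ _ _ X _ mpos.
Let Xn := comp_RV _ _ _ _ X _ mneg.

Let part_moment (phi : R -> R) (mphi : measurable_fun setT phi) :
  (forall x, 0 <= phi x <= `|x|) ->
  ('E_P[fun w => (comp_RV _ _ _ _ X _ mphi 0%N w `^ p)%R] < +oo)%E.
Proof.
move=> phi_le; apply: le_lt_trans X_moment; apply: ge0_expectation_le.
- by apply: (measurableT_comp (measurable_powR _)).
- apply: (measurableT_comp (measurable_powR _)); exact: measurableT_comp.
move=> w; rewrite powR_ge0/=; have /andP[phi0 phiX] := phi_le (X 0%N w).
by rewrite ge0_ler_powR ?nnegrE// ltW.
Qed.

Let pos_le (x : R) : 0 <= Num.max x 0 <= `|x|.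
Proof. by rewrite le_max lexx orbT/= ge_max ler_norm normr_ge0. Qed.

Let neg_le (x : R) : 0 <= Num.max (- x) 0 <= `|x|.
Proof. by rewrite le_max lexx orbT/= ge_max -normrN ler_norm normr_ge0. Qed.

Let Xp0 i w : 0 <= Xp i w. Proof. by have /andP[] := pos_le (X i w). Qed.
Let Xn0 i w : 0 <= Xn i w. Proof. by have /andP[] := neg_le (X i w). Qed.

Let XE i w : X i w = Xp i w - Xn i w.
Proof.
rewrite /=; have [x0|/ltW x0] := leP 0 (X i w).
  by rewrite max_r ?oppr_le0// subr0.
by rewrite max_l ?oppr_ge0// sub0r opprK.
Qed.

Let partial_sumE n w : partial_sum X n w = partial_sum Xp n w - partial_sum Xn n w.
Proof. by rewrite /partial_sum -sumrB; apply: eq_bigr => i _; exact: XE. Qed.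

Let Lfun1_nonneg (Y : {RV P >-> R}) : (forall w, 0 <= Y w) ->
  ('E_P[Y] \is a fin_num)%E -> (Y : T -> R) \in Lfun P 1.
Proof.
move=> Y0; rewrite unlock ge0_fin_numE; last first.
  by apply: integral_ge0 => w _; rewrite lee_fin.
move=> Yoo; apply/Lfun1_integrable/integrableP; split; first exact/measurable_EFinP.
by under eq_integral do rewrite gee0_abs ?lee_fin//.
Qed.

Let Xp1 : 1 <= p -> (Xp 0%N : T -> R) \in Lfun P 1.
Proof.
move=> p1; apply: Lfun1_nonneg => //.
by apply: (nonneg_expectation_fin_num _ _ _ _ Xp p) => //; exact: part_moment.
Qed.

Let Xn1 : 1 <= p -> (Xn 0%N : T -> R) \in Lfun P 1.
Proof.
move=> p1; apply: Lfun1_nonneg => //.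
by apply: (nonneg_expectation_fin_num _ _ _ _ Xn p) => //; exact: part_moment.
Qed.

Let X0E : (X 0%N : T -> R) = Xp 0%N \- Xn 0%N.
Proof. by apply/funext => w; exact: XE. Qed.

Lemma integrable_of_moment : 1 <= p -> P.-integrable [set: T] (EFin \o X 0%N).
Proof.
by move=> p1; apply/Lfun1_integrable; rewrite X0E rpredB// (Xp1, Xn1).
Qed.

Lemma ae_cvg_of_moment : {ae P, forall w,
  (partial_sum X n w - n%:R * centering p (X 0%N)) / (n%:R `^ p^-1)
    @[n --> \oo] --> (0 : R)}.
Proof.
have Ip := identically_distributed_comp _ _ _ _ X _ mpos X_ident.
have In := identically_distributed_comp _ _ _ _ X _ mneg X_ident.
have Dp := pairwise_independent_comp _ _ _ _ X _ mpos X_indep.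
have Dn := pairwise_independent_comp _ _ _ _ X _ mneg X_indep.
have Mp := part_moment _ mpos pos_le.
have Mn := part_moment _ mneg neg_le.
rewrite /centering; have [p1|p1] := ltP p 1.
  have := nonneg_partial_sum_cvg0 _ _ _ _ Xp p Ip Xp0 p_gt0 Mp p1.
  have := nonneg_partial_sum_cvg0 _ _ _ _ Xn p In Xn0 p_gt0 Mn p1.
  apply: filterS2 => w cn cp.
  have E n : (partial_sum X n w - n%:R * 0) / (n%:R `^ p^-1) =
      partial_sum Xp n w / n%:R `^ p^-1 - partial_sum Xn n w / n%:R `^ p^-1.
    by rewrite partial_sumE mulr0 subr0 mulrBl.
  exact: cvg0_sub E cp cn.
have := nonneg_centered_sum_cvg0 _ _ _ _ Xp p Ip Xp0 p_gt0 Mp Dp p_lt2 p1.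
have := nonneg_centered_sum_cvg0 _ _ _ _ Xn p In Xn0 p_gt0 Mn Dn p_lt2 p1.
(* [fine] respects this difference because p >= 1 makes both means finite. *)
have -> : fine 'E_P[X 0%N] = fine 'E_P[Xp 0%N] - fine 'E_P[Xn 0%N].
  by rewrite X0E expectationB ?Xp1 ?Xn1// fineB// expectation_fin_num// (Xp1, Xn1).
apply: filterS2 => w cn cp.
have E n : (partial_sum X n w - n%:R * (fine 'E_P[Xp 0%N] - fine 'E_P[Xn 0%N])) /
    (n%:R `^ p^-1) =
    (partial_sum Xp n w - n%:R * fine 'E_P[Xp 0%N]) / n%:R `^ p^-1 -
    (partial_sum Xn n w - n%:R * fine 'E_P[Xn 0%N]) / n%:R `^ p^-1.
  by rewrite partial_sumE -mulrBl; congr (_ / _); ring.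
exact: cvg0_sub E cp cn.
Qed.

End parts.

Theorem theorem2 (d : measure_display) (T : measurableType d) (R : realType)
    (P : probability T R) (X : nat -> {RV P >-> R}) (p : R)
    (X_indep : pairwise_independent X) (X_ident : identically_distributed X)
    (p_gt0 : 0 < p) (p_lt2 : p < 2) :
  ('E_P[fun w => (`|X 0%N w| `^ p)%R] < +oo)%E
  <->
  ((1 <= p -> P.-integrable [set: T] (EFin \o X 0%N)) /\
   {ae P, forall w,
     (partial_sum X n w - n%:R * centering p (X 0%N)) / (n%:R `^ p^-1)
       @[n --> \oo] --> (0 : R)}).
Proof.
split=> [Xp|[_ cX]].
  split; last exact: ae_cvg_of_moment.
  exact: integrable_of_moment.
apply: moment_of_eventually_le => //; apply: filterS cX => w cX.
exact: (eventually_le_of_cvg0 _ p (centering p (X 0%N)) (fun k => X k w)).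
Qed.
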